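(* Let $(\mathbb F,\star)\in\{(\mathbb C,* ),(\mathbb R,\top)\}$ and let $\lambda E-Q$ with $E,Q\in\mathbb F^{n,n}$ be a regular pencil. Then $E^\star Q=Q^\star E$ if and only if there exist a unitary (in the case $\mathbb F=\mathbb R$: real orthogonal) matrix $U\in\mathbb F^{n,n}$ and an invertible matrix $X\in\mathbb F^{n,n}$ such that $UEX$ and $UQX$ are diagonal and real, and satisfy $$(UEX)^2+(UQX)^2=I_n.$$ Moreover (when $E^\star Q=Q^\star E$), $U$ and $X$ can be chosen such that one of the matrices $UEX$ or $UQX$ is nonnegative. If, in addition, $E^\star Q\ge 0$, then $U$ and $X$ can be chosen such that $UEX$ and $UQX$ are both nonnegative.
   Context: $*$ is conjugate transpose, $\top$ is transpose. A square pencil $\lambda E-Q$ is regular if $\det(\lambda_0E-Q)\neq0$ for some $\lambda_0\in\mathbb C$. $W\ge0$ means $W$ is Hermitian (real symmetric) positive semidefinite; for a real diagonal matrix, nonnegative means all diagonal entries are $\ge0$. *)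

(* Defs.v *)
From mathcomp Require Export all_boot all_order all_algebra.
From mathcomp Require Export reals.
From mathcomp Require Export complex.

Set Implicit Arguments.
Unset Strict Implicit.
Unset Printing Implicit Defensive.

Import Order.TTheory GRing.Theory Num.Theory.

Local Open Scope ring_scope.
Local Open Scope sesquilinear_scope.

Definition regular_pencil (F : fieldType) (n : nat) (E Q : 'M[F]_n) : Prop :=
  exists lambda0 : F, \det (lambda0 *: E - Q) != 0.

Definition orthogonal_mx (R : realFieldType) (n : nat) (U : 'M[R]_n) : Prop :=
  U *m U^T = 1%:M.

Definition herm_psd (C : numClosedFieldType) (n : nat) (W : 'M[C]_n) : Prop :=
  W \is hermsymmx /\ forall x : 'cV[C]_n, 0 <= (x^t* *m W *m x) 0 0.

Definition sym_psd (R : realFieldType) (n : nat) (W : 'M[R]_n) : Prop :=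
  W \is symmetricmx /\ forall x : 'cV[R]_n, 0 <= (x^T *m W *m x) 0 0.

(* Applied to real diagonal matrices only: off-diagonal entries are not
   constrained, and over a complex field [0 <= z] also says that z is real. *)
Definition nonneg_diag (F : numDomainType) (n : nat) (D : 'M[F]_n) : Prop :=
  forall i, 0 <= D i i.

Definition real_diag_unit_pair (F : numDomainType) (n : nat) (A B : 'M[F]_n) :
    Prop :=
  [/\ is_diag_mx A /\ A \is a realmx,
      is_diag_mx B /\ B \is a realmx
    & A ^+ 2 + B ^+ 2 = 1%:M].

Definition unitary_reduction (C : numClosedFieldType) (n : nat)
    (E Q U X : 'M[C]_n) : Prop :=
  [/\ U \is unitarymx, X \in unitmx
    & real_diag_unit_pair (U *m E *m X) (U *m Q *m X)].

(* Over a real field the realness clauses hold automatically. *)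
Definition orthogonal_reduction (R : realFieldType) (n : nat)
    (E Q U X : 'M[R]_n) : Prop :=
  [/\ orthogonal_mx U, X \in unitmx
    & real_diag_unit_pair (U *m E *m X) (U *m Q *m X)].

(* Main.v *)
Require Import Defs.
From mathcomp Require Import ring.

(** Write [M^h] for the conjugate transpose over [C] and for the transpose over
[R].  Regularity says in particular that [E] and [Q] have no common kernel
vector, so that [E^h E + Q^h Q] is positive definite and can be turned into the
identity by a congruence; absorbing it into [X], one may assume that the
stacked matrix [E; Q] has orthonormal columns ([normalize_pencil]).

The condition [E^h Q = Q^h E] then makes the square matrix with block rows
[E, -Q] and [Q, E] unitary on one side, hence on both, which gives the dual
identities [E E^h + Q Q^h = 1] and [E Q^h = Q E^h] ([rows_of_isometry]).  They
imply that the Hermitian matrices [E^h E] and [E^h Q] commute and that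
[(E^h Q)^2 = E^h E (1 - E^h E)].  Diagonalize both by one unitary [W], with
diagonals [a] and [b]; thus [b_i^2 = a_i (1 - a_i)], and there are real [c_i]
and [s_i] with [c_i^2 = a_i], [s_i^2 = 1 - a_i] and [c_i s_i = b_i].  With
[C = diag c] and [S = diag s], the matrix [U = C W E^h + S W Q^h] satisfies
[U E W^h = C] and [U Q W^h = S], from which [U U^h = C^2 + S^2 = 1]
([isometry_reduction]).

The signs are free up to [c_i s_i = b_i]: take [c >= 0], and then [s >= 0] as
well when [E^h Q >= 0].  Exchanging the roles of [E] and [Q] gives the variant
with [U Q X >= 0].

Apart from square roots, the argument only uses that two commuting Hermitian
matrices have a common unitary diagonalization.  Over [C] this is the spectral
theorem for the normal matrix [A + i B] ([hermitian_codiag]); over [R] it is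
proved by deflating a common real eigenvector ([symmetric_codiag]). *)

Set Implicit Arguments.
Unset Strict Implicit.
Unset Printing Implicit Defensive.

Import Order.TTheory GRing.Theory Num.Theory.

Local Open Scope ring_scope.
Local Open Scope sesquilinear_scope.

(** * Reduction over a field with an involution *)

Section Reduction.

Variables (F : numFieldType) (conj : {rmorphism F -> F}).
Local Notation "M ^h" := (M ^t conj) (at level 8, format "M ^h").

Hypothesis conjK : involutive conj.
Hypothesis conj_ge0 : forall x, 0 <= conj x * x.
Hypothesis conj_real : {in Num.real, conj =1 id}.
Hypothesis sqrt_ex : forall x : F, 0 <= x -> exists2 y, 0 <= y & y ^+ 2 = x.
Hypothesis codiag : forall n (A B : 'M[F]_n),
  A^h = A -> B^h = B -> A *m B = B *m A ->
  exists (W : 'M_n) a b, [/\ W *m W^h = 1%:M, W *m A *m W^h = diag_mx a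
                  & W *m B *m W^h = diag_mx b].

(** Left abstract so that the results below specialize, by conversion, both to
[unitarymx] and to [orthogonal_mx]. *)
Variable orth : forall n, 'M[F]_n -> Prop.
Hypothesis orthP : forall n (U : 'M[F]_n), orth U <-> U *m U^h = 1%:M.

(** ** The adjoint and Gram matrices *)

Lemma adjK m n (A : 'M[F]_(m, n)) : A^h^h = A.
Proof. by apply/matrixP => i j; rewrite !mxE conjK. Qed.

Lemma adjM m n p (A : 'M[F]_(m, n)) (B : 'M[F]_(n, p)) :
  (A *m B)^h = B^h *m A^h.
Proof. by rewrite trmx_mul map_mxM. Qed.

Lemma adjD m n (A B : 'M[F]_(m, n)) : (A + B)^h = A^h + B^h.
Proof. by rewrite linearD map_mxD. Qed.

Lemma adj_diag_real n (d : 'rV[F]_n) :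
  d \is a realmx -> (diag_mx d)^h = diag_mx d.
Proof.
move=> /mxOverP dR; apply/matrixP => i j; rewrite !mxE eq_sym.
by case: eqP => [->|_]; rewrite ?mulr0n ?rmorph0 // !mulr1n conj_real.
Qed.

Lemma gram_diagE m n (Y : 'M[F]_(m, n)) i :
  (Y^h *m Y) i i = \sum_k conj (Y k i) * Y k i.
Proof. by rewrite mxE; apply: eq_bigr => k _; rewrite !mxE. Qed.

Lemma gram_diag_ge0 m n (Y : 'M[F]_(m, n)) i : 0 <= (Y^h *m Y) i i.
Proof. by rewrite gram_diagE sumr_ge0. Qed.

Lemma gram_diag_eq0 m n (Y : 'M[F]_(m, n)) i :
  (Y^h *m Y) i i = 0 -> col i Y = 0.
Proof.
rewrite gram_diagE => /eqP; rewrite psumr_eq0 // => /allP Y0.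
apply/colP => k; rewrite !mxE; have := Y0 k (mem_index_enum k).
by rewrite mulf_eq0 fmorph_eq0 orbb => /eqP.
Qed.

(** ** Pencils with orthonormal stacked columns *)

(** Both conclusions are blocks of [G G^h = 1], where [G] has block rows
[E, -Q] and [Q, E]; the hypotheses are the blocks of [G^h G = 1]. *)
Lemma rows_of_isometry n (E Q : 'M[F]_n) :
  E^h *m E + Q^h *m Q = 1%:M -> E^h *m Q = Q^h *m E ->
  E *m E^h + Q *m Q^h = 1%:M /\ E *m Q^h = Q *m E^h.
Proof.
move=> EQ1 EQsym; pose G := block_mx E (- Q) Q E.
have Gh : G^h = block_mx E^h Q^h (- Q^h) E^h.
  by rewrite tr_block_mx map_block_mx linearN /= map_mxN.
have /mulmx1C : G^h *m G = 1%:M.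
  rewrite Gh mulmx_block !mulNmx !mulmxN opprK EQ1 EQsym addNr.
  by rewrite [X in block_mx _ _ _ X]addrC EQ1 -scalar_mx_block.
rewrite Gh mulmx_block !mulNmx !mulmxN opprK (@scalar_mx_block _ n n).
by case/eq_block_mx => -> /eqP + _ _; rewrite subr_eq0 => /eqP ->.
Qed.

(** Since [b^2 = a (1 - a)], the nonnegative square roots of [a] and [1 - a]
multiply to [b] or to [- b]; the sign is put on the second one.  This also
covers [a = 0], where [b] leaves the sign of [s] undetermined. *)
Lemma signed_sqrt_pair (a b : F) :
  0 <= a -> 0 <= 1 - a -> b ^+ 2 = a * (1 - a) ->
  exists c s, [/\ 0 <= c, s \is Num.real, c ^+ 2 = a & s ^+ 2 = 1 - a] /\
    c * s = b /\ (0 <= b -> 0 <= s).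
Proof.
move=> a0 a1 bE; have [c c0 cE] := sqrt_ex a0; have [s s0 sE] := sqrt_ex a1.
have : (c * s) ^+ 2 == b ^+ 2 by rewrite bE exprMn cE sE.
rewrite eqf_sqr => /orP [] /eqP csb.
  by exists c, s; rewrite ger0_real.
have [b0|bN0] := boolP (0 <= b).
  (* Here [b = - c * s <= 0] as well, so the nonnegative [s] still works. *)
  have bz : b = 0.
    by apply/eqP; rewrite eq_le b0 -oppr_ge0 -csb mulr_ge0.
  by exists c, s; rewrite ger0_real // csb bz oppr0.
by exists c, (- s); rewrite rpredN ger0_real // sqrrN mulrN csb opprK.
Qed.

Definition adj_psd n (W : 'M[F]_n) :=
  forall x : 'cV[F]_n, 0 <= (x^h *m W *m x) 0 0.

Lemma mx_diag_psd n (X W : 'M[F]_n) i : adj_psd W -> 0 <= (X^h *m W *m X) i i.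
Proof.
move=> /(_ (col i X)); rewrite -!mulmxA !(mxE, summxE).
congr (0 <= _); apply: eq_bigr => k _; rewrite !mxE; congr (_ * _).
by apply: eq_bigr => l _; rewrite !mxE.
Qed.

(** Diagonalizing [E^h E] and [E^h Q] by [W] yields the squares [c^2] and the
products [c s] of the sought diagonal entries.  The formula for [U] is forced:
if [U E W^h = C] and [U Q W^h = S] with [U] unitary and [C^2 + S^2 = 1], then
[U^h = U^h (C C + S S) = E W^h C + Q W^h S]. *)
Lemma isometry_reduction n (E Q : 'M[F]_n) :
  E^h *m E + Q^h *m Q = 1%:M -> E^h *m Q = Q^h *m E ->
  exists (U V : 'M_n) (c s : 'rV_n),
    [/\ U *m U^h = 1%:M, V *m V^h = 1%:M,
        U *m E *m V = diag_mx c & U *m Q *m V = diag_mx s] /\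
    [/\ c \is a realmx, s \is a realmx,
        diag_mx c *m diag_mx c + diag_mx s *m diag_mx s = 1%:M,
        forall i, 0 <= c 0 i
      & adj_psd (E^h *m Q) -> forall i, 0 <= s 0 i].
Proof.
move=> EQ1 EQsym; have [EQ1' EQsym'] := rows_of_isometry EQ1 EQsym.
have QQ : Q^h *m Q = 1%:M - E^h *m E by rewrite -EQ1 addrC addKr.
have [||| W [a [b [W1 Wa Wb]]]] := @codiag n (E^h *m E) (E^h *m Q).
- by rewrite adjM adjK.
- by rewrite adjM adjK EQsym.
- rewrite -!mulmxA; congr (_ *m _); rewrite !mulmxA.
  have -> : E *m E^h = 1%:M - Q *m Q^h by rewrite -EQ1' addrK.
  rewrite mulmxBl mul1mx -(mulmxA Q _ Q) QQ mulmxBr mulmx1.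
  by rewrite opprB addrC subrK mulmxA.
have W1' := mulmx1C W1.
have W1c : W *m (1%:M - E^h *m E) *m W^h = diag_mx (const_mx 1 - a).
  by rewrite mulmxBr mulmxBl mulmx1 W1 Wa linearB /= diag_const_mx.
have gramW (Y : 'M[F]_n) : W *m (Y^h *m Y) *m W^h = (Y *m W^h)^h *m (Y *m W^h).
  by rewrite adjM adjK !mulmxA.
have a0 i : 0 <= a 0 i.
  by have := gram_diag_ge0 (E *m W^h) i; rewrite -gramW Wa !mxE eqxx.
have a1 i : 0 <= 1 - a 0 i.
  by have := gram_diag_ge0 (Q *m W^h) i; rewrite -gramW QQ W1c !mxE eqxx.
have b2 i : b 0 i ^+ 2 = a 0 i * (1 - a 0 i).
  have : diag_mx b *m diag_mx b = diag_mx a *m diag_mx (const_mx 1 - a).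
    rewrite -Wb -Wa -W1c -QQ !mulmxA -[_ *m W^h *m W]mulmxA W1' mulmx1.
    rewrite -[_ *m W^h *m W]mulmxA W1' mulmx1.
    by rewrite -(mulmxA _ Q E^h) -EQsym' !mulmxA.
  rewrite !mulmx_diag => /matrixP /(_ i i).
  by rewrite !mxE eqxx !mulr1n.
have /fin_all_exists [c /fin_all_exists [s cs]] :=
  fun i => signed_sqrt_pair (a0 i) (a1 i) (b2 i).
pose C := diag_mx (\row_i c i); pose S := diag_mx (\row_i s i).
have CR : \row_i c i \is a realmx.
  by apply/mxOverP => i j; rewrite mxE ger0_real //; case: (cs j) => [[]].
have SR : \row_i s i \is a realmx.
  by apply/mxOverP => i j; rewrite mxE; case: (cs j) => [[]].
pose U := C *m W *m E^h + S *m W *m Q^h.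
have CCSS : C *m C + S *m S = 1%:M.
  rewrite !mulmx_diag -linearD -diag_const_mx; congr diag_mx.
  apply/rowP => i; rewrite !mxE -!expr2.
  by case: (cs i) => [[_ _ -> ->] _]; rewrite addrC subrK.
have UE : U *m E *m W^h = C.
  have -> : U *m E *m W^h = C *m diag_mx a + S *m diag_mx b.
    by rewrite -Wa -Wb !mulmxDl -!mulmxA (mulmxA _ Q) EQsym !mulmxA.
  rewrite !mulmx_diag -linearD; congr diag_mx; apply/rowP => i; rewrite !mxE.
  case: (cs i) => [[_ _ ca sa] [<- _]].
  have -> : s i * (c i * s i) = c i * (s i ^+ 2) by ring.
  by rewrite sa -mulrDr addrC subrK mulr1.
have UQ : U *m Q *m W^h = S.
  have -> : U *m Q *m W^h = C *m diag_mx b + S *m diag_mx (const_mx 1 - a).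
    by rewrite -Wb -W1c -QQ !mulmxDl -!mulmxA.
  rewrite !mulmx_diag -linearD; congr diag_mx; apply/rowP => i; rewrite !mxE.
  case: (cs i) => [[_ _ ca sa] [<- _]].
  have -> : c i * (c i * s i) = s i * (c i ^+ 2) by ring.
  by rewrite ca; ring.
exists U, W^h, (\row_i c i), (\row_i s i); split; split => //.
- have Uh : U^h = E *m W^h *m C + Q *m W^h *m S.
    by rewrite adjD !adjM !adjK !adj_diag_real // !mulmxA.
  by rewrite Uh mulmxDr !mulmxA UE UQ.
- by rewrite adjK.
- by move=> i; rewrite mxE; case: (cs i) => [[]].
- move=> psd i; rewrite mxE; case: (cs i) => _ [_]; apply.
  have := mx_diag_psd (W^h) i psd.
  by rewrite adjK Wb !mxE eqxx.
Qed.

(** ** Reduction of general pencils *)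

Definition adj_reduction n (E Q U X : 'M[F]_n) : Prop :=
  [/\ orth U, X \in unitmx
    & real_diag_unit_pair (U *m E *m X) (U *m Q *m X)].

Definition trivial_common_kernel n (E Q : 'M[F]_n) :=
  forall v : 'cV[F]_n, E *m v = 0 -> Q *m v = 0 -> v = 0.

(** [E^h E + Q^h Q] has positive eigenvalues [d_i], so [X] is its unitary
eigenbasis rescaled by [1 / sqrt d_i]. *)
Lemma normalize_pencil n (E Q : 'M[F]_n) :
  trivial_common_kernel E Q ->
  exists2 X, X \in unitmx
    & (E *m X)^h *m (E *m X) + (Q *m X)^h *m (Q *m X) = 1%:M.
Proof.
move=> kerEQ; pose S := E^h *m E + Q^h *m Q.
have Sh : S^h = S by rewrite adjD !adjM !adjK.
have [W [d [_ [W1 Wd _]]]] := codiag Sh Sh erefl.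
have SE (Y : 'M[F]_n) :
    (E *m Y)^h *m (E *m Y) + (Q *m Y)^h *m (Q *m Y) = Y^h *m S *m Y.
  by rewrite !adjM mulmxDr mulmxDl !mulmxA.
have dE i : d 0 i = ((E *m W^h)^h *m (E *m W^h)) i i
                    + ((Q *m W^h)^h *m (Q *m W^h)) i i.
  have := SE W^h; rewrite adjK Wd => /matrixP /(_ i i).
  by rewrite [RHS]mxE eqxx mulr1n => <-; rewrite mxE.
have d0 i : 0 < d 0 i.
  rewrite lt0r {2}dE addr_ge0 ?gram_diag_ge0 // andbT; apply/eqP => di0.
  have /eqP := dE i; rewrite di0 eq_sym paddr_eq0 ?gram_diag_ge0 //.
  case/andP => /eqP /gram_diag_eq0 + /eqP /gram_diag_eq0.
  rewrite !colE -!mulmxA => /kerEQ vE /vE /(congr1 (mulmx W)).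
  rewrite mulmxA W1 mul1mx mulmx0 => /colP /(_ i) /eqP.
  by rewrite !mxE eqxx oner_eq0.
have /fin_all_exists2 [y y0 yd] := fun i => sqrt_ex (ltW (d0 i)).
pose Z := diag_mx (\row_i (y i)^-1).
have ZR : Z^h = Z.
  by apply: adj_diag_real; apply/mxOverP => i j; rewrite mxE rpredV ger0_real.
have X1 : (W^h *m Z)^h *m S *m (W^h *m Z) = 1%:M.
  rewrite adjM adjK ZR.
  have -> : Z *m W *m S *m (W^h *m Z) = Z *m (W *m S *m W^h) *m Z.
    by rewrite !mulmxA.
  rewrite Wd !mulmx_diag -diag_const_mx; congr diag_mx; apply/rowP => i.
  rewrite !mxE -yd; have yi : y i != 0.
    by apply/eqP => yi; have := d0 i; rewrite -yd yi expr0n ltxx.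
  by field.
exists (W^h *m Z); last by rewrite SE.
by case/mulmx1_unit: X1.
Qed.

Lemma reduction_exists n (E Q : 'M[F]_n) :
  trivial_common_kernel E Q -> E^h *m Q = Q^h *m E ->
  exists U X, [/\ adj_reduction E Q U X, nonneg_diag (U *m E *m X)
                & adj_psd (E^h *m Q) -> nonneg_diag (U *m Q *m X)].
Proof.
move=> kerEQ EQsym; have [X Xu X1] := normalize_pencil kerEQ.
have [|U [V [c [s [[U1 V1 UE UQ] [cR sR cs1 c0 s0]]]]]] :=
  isometry_reduction X1.
  by rewrite !adjM -!mulmxA (mulmxA _ Q X) (mulmxA _ E X) EQsym.
have diagR (d : 'rV[F]_n) : d \is a realmx ->
    is_diag_mx (diag_mx d) /\ diag_mx d \is a realmx.
  move=> /mxOverP dR; split; first exact: diag_mx_is_diag.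
  by apply/mxOverP => i j; rewrite mxE rpredMn.
have UEX : U *m E *m (X *m V) = diag_mx c by rewrite -UE !mulmxA.
have UQX : U *m Q *m (X *m V) = diag_mx s by rewrite -UQ !mulmxA.
exists U, (X *m V); split.
- split; [exact/orthP | |].
    by rewrite unitmx_mul Xu; case/mulmx1_unit: V1.
  by rewrite UEX UQX; split; [exact: diagR | exact: diagR |].
- by move=> i; rewrite UEX mxE eqxx mulr1n.
- move=> psd i; rewrite UQX mxE eqxx mulr1n; apply: s0 => x.
  have := psd (X *m x); rewrite !adjM.
  by rewrite !mulmxA.
Qed.

Lemma reduction_swap n (E Q U X : 'M[F]_n) :
  adj_reduction E Q U X -> adj_reduction Q E U X.
Proof. by case=> U1 Xu [DE DQ EQ1]; split=> //; split=> //; rewrite addrC. Qed.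

Lemma adj_real_diag n (D : 'M[F]_n) : is_diag_mx D -> D \is a realmx -> D^h = D.
Proof.
move=> /diag_mxP [d ->] /mxOverP dR; apply: adj_diag_real.
apply/mxOverP => i j.
by have := dR j j; rewrite mxE eqxx mulr1n ord1.
Qed.

(** The congruence by [X] and the left factor [U] transport the identity to
[UEX] and [UQX], which are self-adjoint and commute because they are real and
diagonal. *)
Lemma reduction_symmetric n (E Q U X : 'M[F]_n) :
  adj_reduction E Q U X -> E^h *m Q = Q^h *m E.
Proof.
case=> /orthP U1 Xu [[DE RE] [DQ RQ] _].
have U1' := mulmx1C U1.
have unX (M : 'M[F]_n) : U^h *m (U *m M *m X) *m invmx X = M.
  by rewrite -!mulmxA mulmxV // mulmx1 mulmxA U1' mul1mx.
have reduce M N : M^h *m N =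
  (invmx X)^h *m ((U *m M *m X)^h *m (U *m N *m X)) *m invmx X.
  rewrite -{1}[M]unX -{1}[N]unX.
  move: (U *m M *m X) (U *m N *m X) => A B.
  by rewrite !adjM adjK -!mulmxA (mulmxA U U^h) U1 mul1mx.
have DEQ : (U *m E *m X) *m (U *m Q *m X) = (U *m Q *m X) *m (U *m E *m X).
  by case/diag_mxP: DE => c ->; case/diag_mxP: DQ => s ->; apply: diag_mxC.
by rewrite [LHS]reduce [RHS]reduce !(adj_real_diag DE, adj_real_diag DQ) // DEQ.
Qed.

Lemma reduction_of_trivial_common_kernel n (E Q : 'M[F]_n) :
  trivial_common_kernel E Q ->
  (E^h *m Q = Q^h *m E <-> exists U X, adj_reduction E Q U X) /\
  (E^h *m Q = Q^h *m E ->
   [/\ exists U X, adj_reduction E Q U X /\ nonneg_diag (U *m E *m X),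
       exists U X, adj_reduction E Q U X /\ nonneg_diag (U *m Q *m X)
     & adj_psd (E^h *m Q) ->
       exists U X, [/\ adj_reduction E Q U X, nonneg_diag (U *m E *m X)
                     & nonneg_diag (U *m Q *m X)]]).
Proof.
move=> kerEQ; split; first split.
- by case/(reduction_exists kerEQ) => U [X [red _ _]]; exists U, X.
- by case=> U [X]; apply: reduction_symmetric.
have kerQE : trivial_common_kernel Q E by move=> v Qv Ev; apply: kerEQ.
move=> EQsym; split.
- by have [U [X [red pos _]]] := reduction_exists kerEQ EQsym; exists U, X.
- have [U [X [/reduction_swap red pos _]]] :=
    reduction_exists kerQE (esym EQsym).
  by exists U, X.
- move=> psd; have [U [X [red pos posQ]]] := reduction_exists kerEQ EQsym.
  by exists U, X; split=> //; apply: posQ.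
Qed.

End Reduction.

(** * Simultaneous diagonalization of commuting Hermitian matrices *)

(** [Z = A + i B] is normal, and a unitary diagonalization of [Z] also
diagonalizes its adjoint [A - i B], hence [A] and [B]. *)
Lemma hermitian_codiag (C : numClosedFieldType) n (A B : 'M[C]_n) :
  A^t* = A -> B^t* = B -> A *m B = B *m A ->
  exists (W : 'M_n) a b, [/\ W *m W^t* = 1%:M, W *m A *m W^t* = diag_mx a
                           & W *m B *m W^t* = diag_mx b].
Proof.
move=> Ah Bh AB; pose Z := A + 'i *: B.
have Zh : Z^t* = A - 'i *: B.
  by rewrite linearD /= map_mxD Ah linearZ /= map_mxZ Bh /= conjCi scaleNr.
have Znormal : Z \is normalmx.
  apply/normalmxP; rewrite Zh mulmxBl mulmxBr !mulmxDl !mulmxDr.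
  by rewrite -!scalemxAl -!scalemxAr AB.
have Wu := spectral_unitarymx Z.
have /orthomx_spectralP := Znormal; set W := spectralmx Z in Wu *.
set d := spectral_diag Z; rewrite invmx_unitary // => ZE.
have W1 : W *m W^t* = 1%:M by apply/unitarymxP.
have WZ : W *m Z *m W^t* = diag_mx d.
  by rewrite ZE !mulmxA W1 mul1mx -mulmxA W1 mulmx1.
have WZh : W *m Z^t* *m W^t* = diag_mx (map_mx Num.conj d).
  have := congr1 (fun M : 'M_n => M^t*) WZ.
  by rewrite /= tr_diag_mx map_diag_mx !trmx_mul !map_mxM trmxCK !mulmxA.
have i0 : 'i != 0 :> C by apply: neq0Ci.
have two0 : 2 != 0 :> C by rewrite pnatr_eq0.
exists W, (2^-1 *: (d + map_mx Num.conj d)),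
  ((2 * 'i)^-1 *: (d - map_mx Num.conj d)).
split=> //.
- rewrite linearZ linearD /= -WZ -WZh -mulmxDl -mulmxDr Zh.
  rewrite addrACA subrr addr0 -mulr2n -scaler_nat.
  by rewrite -scalemxAr -scalemxAl scalerA mulVf // scale1r.
- rewrite linearZ linearB /= -WZ -WZh -mulmxBl -mulmxBr Zh.
  rewrite opprB [Z]addrC addrACA subrr addr0 -mulr2n -scaler_nat scalerA.
  by rewrite -scalemxAr -scalemxAl scalerA mulVf ?scale1r // mulf_neq0.
Qed.

(** * Simultaneous diagonalization of commuting symmetric matrices *)

Section Real.
Variable R : rcfType.

Lemma row_sqnorm_ge0 n (v : 'rV[R]_n) : 0 <= (v *m v^T) 0 0.
Proof. by rewrite mxE sumr_ge0 // => i _; rewrite mxE -expr2 sqr_ge0. Qed.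

Lemma row_sqnorm_eq0 n (v : 'rV[R]_n) : ((v *m v^T) 0 0 == 0) = (v == 0).
Proof.
apply/eqP/eqP => [|->]; last by rewrite mul0mx mxE.
rewrite mxE => /eqP; rewrite psumr_eq0 => [/allP v0|i _]; last first.
  by rewrite mxE -expr2 sqr_ge0.
apply/rowP => i; have := v0 i (mem_index_enum i).
by rewrite !mxE mulf_eq0 orbb => /eqP.
Qed.

(** A complex common eigenvector [x + i y] exists because [A] and [B] commute.
By symmetry its eigenvalues are real, so [x] and [y] satisfy the same
eigenvalue equations, and one of them is nonzero. *)
Lemma symmetric_common_eigenvector n (A B : 'M[R]_n) :
  (0 < n)%N -> A^T = A -> B^T = B -> A *m B = B *m A ->
  exists v : 'rV_n, exists a b,
    [/\ v != 0, v *m A = a *: v & v *m B = b *: v].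
Proof.
move=> n0 Asym Bsym AB; pose f := real_complex R.
have [|v vN0 /andP [/sub_rVP [a va] /sub_rVP [b vb]]] :=
  common_eigenvector2 (A := map_mx f A) (B := map_mx f B) n0.
  by rewrite -!map_mxM AB.
pose x := map_mx (@complex.Re R) v; pose y := map_mx (@complex.Im R) v.
have ReM M : map_mx (@complex.Re R) (v *m map_mx f M) = x *m M.
  apply/rowP => i; rewrite !mxE raddf_sum; apply: eq_bigr => k _.
  by rewrite !mxE; case: (v 0 k) => p q /=; rewrite mulr0 subr0.
have ImM M : map_mx (@complex.Im R) (v *m map_mx f M) = y *m M.
  apply/rowP => i; rewrite !mxE raddf_sum; apply: eq_bigr => k _.
  by rewrite !mxE; case: (v 0 k) => p q /=; rewrite mulr0 add0r.
have split_eig c :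
    map_mx (@complex.Re R) (c *: v) = complex.Re c *: x - complex.Im c *: y /\
    map_mx (@complex.Im R) (c *: v) = complex.Re c *: y + complex.Im c *: x.
  by split; apply/rowP => i; rewrite !mxE; case: c (v 0 i) => [p q] [r s].
have xyN0 : 0 < (x *m x^T) 0 0 + (y *m y^T) 0 0.
  rewrite lt0r paddr_eq0 ?row_sqnorm_ge0 // addr_ge0 ?row_sqnorm_ge0 // andbT.
  rewrite !row_sqnorm_eq0; apply: contra vN0 => /andP [/eqP x0 /eqP y0].
  apply/eqP/rowP => i; have /rowP /(_ i) := x0; have /rowP /(_ i) := y0.
  by rewrite !mxE; case: (v 0 i) => p q /= -> ->.
have real_eig M c : M^T = M -> v *m map_mx f M = c *: v ->
    x *m M = complex.Re c *: x /\ y *m M = complex.Re c *: y.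
  move=> Msym vM; have [ReE ImE] := split_eig c.
  rewrite -vM ReM in ReE; rewrite -vM ImM in ImE.
  have : (x *m M) *m y^T = x *m (y *m M)^T by rewrite trmx_mul Msym mulmxA.
  (* With eigenvalue [p + i r], this identity [<x M, y> = <x, y M>] reads
     [r (|x|^2 + |y|^2) = 0]. *)
  rewrite ReE ImE [(_ + _)^T]linearD /= ![(_ *: _)^T]linearZ /=.
  rewrite mulmxDl mulNmx mulmxDr -!scalemxAl -!scalemxAr => /addrI /eqP.
  rewrite eq_sym -subr_eq0 opprK -scalerDr => /eqP /matrixP /(_ 0 0) /eqP.
  rewrite [X in X == _]mxE [X in _ * X]mxE [X in _ == X]mxE mulf_eq0.
  case/orP => [/eqP -> | /eqP xy0].
    by rewrite !scale0r subr0 addr0.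
  by rewrite xy0 ltxx in xyN0.
have [xA yA] := real_eig _ _ Asym va; have [xB yB] := real_eig _ _ Bsym vb.
have [x0|xN0] := eqVneq x 0; last by exists x, (complex.Re a), (complex.Re b).
exists y, (complex.Re a), (complex.Re b); split=> //.
by apply: contraTneq xyN0 => ->; rewrite x0 !mul0mx !mxE addr0 ltxx.
Qed.

(** The Householder reflection exchanging [v] and the first basis vector. *)
Lemma orthogonal_with_first_row n (v : 'rV[R]_n.+1) :
  v *m v^T = 1%:M -> exists2 P : 'M_n.+1, P *m P^T = 1%:M & row 0 P = v.
Proof.
move=> v1; pose e : 'rV[R]_n.+1 := delta_mx 0 0; pose w := v - e.
have [w0|wN0] := eqVneq w 0.
  exists 1%:M; first by rewrite trmx1 mulmx1.
  by rewrite rowE mulmx1; apply/esym/eqP; rewrite -subr_eq0 -/e -/w w0.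
pose q := (w *m w^T) 0 0.
have q0 : q != 0 by rewrite row_sqnorm_eq0.
have wwE : w *m w^T = q%:M by rewrite [LHS]mx11_scalar.
have ee : e *m e^T = 1%:M.
  by rewrite trmx_delta mul_delta_mx; apply/rowP => i; rewrite !ord1 !mxE.
have ve : (v *m e^T) 0 0 = v 0 0 by rewrite trmx_delta -colE mxE.
have ev : e *m v^T = v *m e^T.
  have tr1 (M : 'M[R]_1) : M^T = M by apply/matrixP => i j; rewrite !ord1 mxE.
  by rewrite -[LHS]tr1 trmx_mul trmxK.
have qE : q = 2 * (1 - v 0 0).
  rewrite /q linearB /= mulmxBr !mulmxBl ev v1 ee -ve !mxE /= !mulr1n; ring.
have ew : e *m w^T = (- (q / 2))%:M.
  rewrite [LHS]mx11_scalar linearB /= mulmxBr ee ev qE; congr _%:M.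
  by rewrite -ve !mxE /= mulr1n; field.
pose P := 1%:M - (2 / q) *: (w^T *m w).
have Psym : P^T = P by rewrite linearB linearZ /= trmx1 trmx_mul trmxK.
exists P.
  rewrite Psym mulmxBr mulmx1 {1}/P mulmxBl mul1mx -scalemxAl -scalemxAr.
  rewrite mulmxA -(mulmxA _ w) wwE mul_mx_scalar -scalemxAl !scalerA.
  have -> : 2 / q * (2 / q * q) = 2 / q + 2 / q by field.
  by rewrite scalerDl opprB addrK subrK.
rewrite rowE -/e mulmxBr mulmx1 -scalemxAr mulmxA ew mul_scalar_mx scalerA.
have -> : 2 / q * - (q / 2) = -1 by field; rewrite q0.
by rewrite scaleN1r opprK addrC subrK.
Qed.
(** By induction on the size: in an orthonormal basis that starts with a common
eigenvector, both matrices are block diagonal with a scalar first block. *)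
Lemma symmetric_codiag n (A B : 'M[R]_n) :
  A^T = A -> B^T = B -> A *m B = B *m A ->
  exists (W : 'M_n) a b, [/\ W *m W^T = 1%:M, W *m A *m W^T = diag_mx a
                           & W *m B *m W^T = diag_mx b].
Proof.
elim: n => [|n IH] in A B * => Asym Bsym AB.
  by exists 1%:M, 0, 0; split; apply/matrixP => - [].
have [u [a [b [uN0 uA uB]]]] :=
  symmetric_common_eigenvector (ltn0Sn n) Asym Bsym AB.
pose r := (Num.sqrt ((u *m u^T) 0 0))^-1; pose v := r *: u.
have uu0 : 0 < (u *m u^T) 0 0 by rewrite lt0r row_sqnorm_eq0 uN0 row_sqnorm_ge0.
have v1 : v *m v^T = 1%:M.
  rewrite linearZ /= -scalemxAr -scalemxAl scalerA -expr2 exprVn.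
  rewrite sqr_sqrtr ?ltW //.
  by rewrite [u *m _]mx11_scalar scale_scalar_mx mxE mulr1n mulVf ?gt_eqF.
have [P P1 rowP0] := orthogonal_with_first_row v1.
have deflate (M : 'M[R]_n.+1) c : M^T = M -> u *m M = c *: u ->
    exists2 M' : 'M_n, M'^T = M'
      & P *m M *m P^T = block_mx c%:M 0 0 M' :> 'M_(1 + n).
  move=> Msym uM; pose N : 'M_(1 + n) := P *m M *m P^T.
  have Nsym : N^T = N by rewrite !trmx_mul trmxK Msym mulmxA.
  have N0 j : N 0 j = c *+ (j == 0).
    have vM : v *m M = c *: v by rewrite -scalemxAl uM !scalerA mulrC.
    have : row 0 N = c *: delta_mx 0 0.
      by rewrite !row_mul rowP0 vM -scalemxAl -rowP0 -row_mul P1 rowE mulmx1.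
    by move=> /rowP /(_ j); rewrite !mxE mulr_natr.
  have i0 : lshift n (0 : 'I_1) = 0 by apply: val_inj.
  exists (drsubmx N); first by rewrite -[in RHS]Nsym trmx_drsub.
  have urN : ursubmx N = 0.
    by apply/matrixP => i j; rewrite ord1 [LHS]mxE [LHS]mxE i0 N0 [RHS]mxE.
  rewrite -/N -[LHS]submxK urN; congr block_mx.
    by apply/matrixP => i j; rewrite !ord1 [LHS]mxE [LHS]mxE i0 N0 [RHS]mxE.
  by apply/eqP; rewrite -trmx_eq0 trmx_dlsub Nsym urN.
have [A' A's PA] := deflate A a Asym uA.
have [B' B's PB] := deflate B b Bsym uB.
have AB' : A' *m B' = B' *m A'.
  have : (P *m A *m P^T) *m (P *m B *m P^T) =
         (P *m B *m P^T) *m (P *m A *m P^T).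
    rewrite !mulmxA -[_ *m P^T *m P]mulmxA (mulmx1C P1) mulmx1.
    rewrite -[_ *m P^T *m P]mulmxA (mulmx1C P1) mulmx1.
    by rewrite -!(mulmxA P) AB.
  rewrite PA PB !(@mulmx_block _ 1 n 1 n 1 n) !mul0mx !mulmx0 !addr0 !add0r.
  by case/(@eq_block_mx _ 1 n 1 n).
have [W [a' [b' [W1 WA WB]]]] := IH A' B' A's B's AB'.
pose W' : 'M[R]_(1 + n) := block_mx 1%:M 0 0 W.
have W'T : W'^T = block_mx 1%:M 0 0 W^T.
  by rewrite tr_block_mx trmx1 !trmx0.
have W'1 : W' *m W'^T = 1%:M.
  rewrite W'T mulmx_block !mul0mx !mulmx0 !addr0 add0r mulmx1 W1.
  by rewrite -scalar_mx_block.
have conjW c (M : 'M[R]_n.+1) M' d :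
    P *m M *m P^T = block_mx c%:M 0 0 M' :> 'M_(1 + n) ->
    W *m M' *m W^T = diag_mx d ->
    (W' *m P) *m M *m (W' *m P)^T =
      diag_mx (row_mx (const_mx c) d : 'rV_(1 + n)).
  move=> PM WM; rewrite trmx_mul.
  have -> : W' *m P *m M *m (P^T *m W'^T) = W' *m (P *m M *m P^T) *m W'^T.
    by rewrite !mulmxA.
  rewrite PM W'T !(@mulmx_block _ 1 n 1 n 1 n) !mul0mx !mulmx0 !addr0 !add0r.
  rewrite mulmx1 mul1mx WM.
  by rewrite diag_mx_row diag_const_mx !mul0mx.
exists (W' *m P), (row_mx (const_mx a) a' : 'rV_(1 + n)),
  (row_mx (const_mx b) b' : 'rV_(1 + n)).
split; [|exact: conjW PA WA|exact: conjW PB WB].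
by rewrite trmx_mul mulmxA -(mulmxA W' P) P1 mulmx1.
Qed.
End Real.

(** * The reduction of regular pencils *)

Lemma regular_trivial_common_kernel (F : numFieldType) n (E Q : 'M[F]_n) :
  regular_pencil E Q -> trivial_common_kernel E Q.
Proof.
case=> l; rewrite -unitfE -unitmxE => lu v Ev Qv.
have : (l *: E - Q) *m v = 0 by rewrite mulmxBl -scalemxAl Ev Qv scaler0 subr0.
by move=> /(congr1 (mulmx (invmx (l *: E - Q)))); rewrite mulKmx // mulmx0.
Qed.

Theorem proposition9 (R : realType) (n : nat) :
  (* the case (C, * ), with C = R[i] *)
  (forall E Q : 'M[R[i]]_n, regular_pencil E Q ->
     (E^t* *m Q = Q^t* *m E <-> exists U X, unitary_reduction E Q U X)
     /\
     (E^t* *m Q = Q^t* *m E ->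
       [/\ exists U X, unitary_reduction E Q U X /\ nonneg_diag (U *m E *m X),
           exists U X, unitary_reduction E Q U X /\ nonneg_diag (U *m Q *m X)
         & herm_psd (E^t* *m Q) ->
             exists U X, [/\ unitary_reduction E Q U X,
                             nonneg_diag (U *m E *m X)
                           & nonneg_diag (U *m Q *m X)]]))
  /\
  (* the case (R, T); regularity is tested at complex lambda0 *)
  (forall E Q : 'M[R]_n,
     regular_pencil (map_mx (real_complex R) E) (map_mx (real_complex R) Q) ->
     (E^T *m Q = Q^T *m E <-> exists U X, orthogonal_reduction E Q U X)
     /\
     (E^T *m Q = Q^T *m E ->
       [/\ exists U X,
             orthogonal_reduction E Q U X /\ nonneg_diag (U *m E *m X),
           exists U X,
             orthogonal_reduction E Q U X /\ nonneg_diag (U *m Q *m X)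
         & sym_psd (E^T *m Q) ->
             exists U X, [/\ orthogonal_reduction E Q U X,
                             nonneg_diag (U *m E *m X)
                           & nonneg_diag (U *m Q *m X)]])).

Proof.
split=> E Q reg.
- have sqrtC_ex (x : R[i]) : 0 <= x -> exists2 y, 0 <= y & y ^+ 2 = x.
    by move=> x0; exists (sqrtC x); rewrite ?sqrtC_ge0 ?sqrtCK.
  have conj_ge0 (x : R[i]) : 0 <= Num.conj x * x.
    by rewrite mulrC mul_conjC_ge0.
  have conj_real : {in Num.real, forall x : R[i], Num.conj x = x}.
    by move=> x /CrealP.
  have unitaryP m (U : 'M[R[i]]_m) : U \is unitarymx <-> U *m U^t* = 1%:M.
    by split=> /unitarymxP.
  have [eqv red] := reduction_of_trivial_common_kernel
    (@conjCK _) conj_ge0 conj_real sqrtC_ex (@hermitian_codiag _) unitaryP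
    (regular_trivial_common_kernel reg).
  split; first exact: eqv.
  by case/red=> redE redQ redEQ; split=> // -[_ /redEQ].
- have mapid m p (M : 'M[R]_(m, p)) : map_mx idfun M = M by exact: map_mx_id.
  have sqrt_ex (x : R) : 0 <= x -> exists2 y, 0 <= y & y ^+ 2 = x.
    by move=> x0; exists (Num.sqrt x); rewrite ?sqrtr_ge0 ?sqr_sqrtr.
  have idfun_mul_ge0 (x : R) : 0 <= idfun x * x by rewrite -expr2 sqr_ge0.
  have codiag m (A B : 'M[R]_m) :
      A^t idfun = A -> B^t idfun = B -> A *m B = B *m A ->
    exists (W : 'M_m) a b,
      [/\ W *m W^t idfun = 1%:M, W *m A *m W^t idfun = diag_mx a
        & W *m B *m W^t idfun = diag_mx b].
    rewrite !mapid => As Bs /(symmetric_codiag As Bs) [W [a [b]]].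
    by exists W, a, b; rewrite mapid.
  have orthP m (U : 'M[R]_m) : orthogonal_mx U <-> U *m U^t idfun = 1%:M.
    by rewrite mapid.
  have kerEQ : trivial_common_kernel E Q.
    move=> v Ev Qv; apply: (map_mx_inj (f := real_complex R)); rewrite map_mx0.
    by apply: (regular_trivial_common_kernel reg);
      rewrite -map_mxM ?Ev ?Qv map_mx0.
  have := reduction_of_trivial_common_kernel (conj := idfun)
    (fun=> erefl) idfun_mul_ge0 (in1W (fun=> erefl)) sqrt_ex
    codiag orthP kerEQ.
  rewrite !mapid => -[eqv red]; split; first exact: eqv.
  case/red=> redE redQ redEQ; split=> // -[_ psd]; apply: redEQ => x.
  by rewrite mapid.
Qed.
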